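(* For every cardinal $\kappa$ with $\kappa\leq\aleph_0$ or $\kappa=2^{\aleph_0}$, there exists $L\in\mathsf{NExt}(\mathsf{S4}_t)$ such that $|\mathsf{PTAB}(L)|=\kappa$.
   Context: Tense formulas are built from propositional variables, $\bot$, $\to$, a future necessity operator $\Box$ and a past possibility operator, written here $\mathsf{P}$ (in a Kripke model, $\mathsf{P}\phi$ holds at $x$ iff $\phi$ holds at some $y$ with $Ryx$; $\Box\phi$ holds at $x$ iff $\phi$ holds at all $y$ with $Rxy$). A (normal) tense logic is a set of formulas containing all classical tautologies, closed under modus ponens and uniform substitution, and such that $\mathsf{P}\phi\to\psi\in L$ iff $\phi\to\Box\psi\in L$. $\mathsf{K}_t$ is the least tense logic and $\mathsf{S4}_t=\mathsf{K}_t\oplus\{\Box p\to p,\ \Box p\to\Box\Box p\}$ (the tense logic of preorders). $\mathsf{NExt}(L)$ is the set of all tense logics extending $L$. A tense logic is tabular if it is the logic of a single finite frame, and pretabular if it is not tabular but every consistent proper extension of it is tabular. $\mathsf{PTAB}(L)$ denotes the set of pretabular logics in $\mathsf{NExt}(L)$. *)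

(* Defs.v *)
From mathcomp Require Import all_boot.
From mathcomp Require Import boolp classical_sets functions cardinality.

Set Implicit Arguments.
Unset Strict Implicit.
Unset Printing Implicit Defensive.

Local Open Scope classical_set_scope.

(* Tense formulas over countably many propositional variables; [Past] is the
   past possibility operator P, [Box] the future necessity operator. *)
Inductive form : Type :=
| Var of nat
| Bot
| Imp of form & form
| Box of form
| Past of form.

Fixpoint subst (s : nat -> form) (phi : form) : form :=
  match phi with
  | Var n => s n
  | Bot => Bot
  | Imp a b => Imp (subst s a) (subst s b)
  | Box a => Box (subst s a)
  | Past a => Past (subst s a)
  end.

(* Classical truth value: variables and formulas headed by a modal operator
   are all treated as atoms, valued by [v]. *)
Fixpoint truth_value (v : form -> bool) (phi : form) : bool :=
  match phi with
  | Bot => false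
  | Imp a b => truth_value v a ==> truth_value v b
  | _ => v phi
  end.

Definition tautology (phi : form) : Prop := forall v, truth_value v phi.

Definition tense_logic (L : set form) : Prop :=
  [/\ tautology `<=` L,
      forall a b, L (Imp a b) -> L a -> L b,
      forall s a, L a -> L (subst s a) &
      forall a b, L (Imp (Past a) b) <-> L (Imp a (Box b))].

Definition oplus (L Sigma : set form) : set form :=
  smallest tense_logic (L `|` Sigma).

Definition Kt : set form := smallest tense_logic set0.

Definition S4t : set form :=
  let p := Var 0 in
  oplus Kt [set phi | phi = Imp (Box p) p \/ phi = Imp (Box p) (Box (Box p))].

Definition NExt (L : set form) : set (set form) :=
  [set L' | tense_logic L' /\ L `<=` L'].

Record frame := Frame {
  world :> Type;
  acc : world -> world -> Prop;
  world_inhabited : inhabited world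
}.

Fixpoint sat (F : frame) (V : nat -> set F) (x : F) (phi : form) : Prop :=
  match phi with
  | Var n => V n x
  | Bot => False
  | Imp a b => sat V x a -> sat V x b
  | Box a => forall y, acc x y -> sat V y a
  | Past a => exists y, acc y x /\ sat V y a
  end.

Definition Log (F : frame) : set form :=
  [set phi | forall (V : nat -> set F) (x : F), sat V x phi].

Definition tabular (L : set form) : Prop :=
  exists F : frame, finite_set [set: F] /\ L = Log F.

Definition consistent (L : set form) : Prop := ~ L Bot.

(* Frames being nonempty, the inconsistent logic is not the logic of any frame,
   and it has no consistent extension; [consistent L] keeps it from being
   vacuously pretabular. (Counting it as tabular, as the logic of the empty
   frame, would give the same pretabular logics.) *)
Definition pretabular (L : set form) : Prop :=
  [/\ consistent L,
      ~ tabular L &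
      forall L', tense_logic L' -> L `<` L' -> consistent L' -> tabular L'].

Definition PTAB (L : set form) : set (set form) :=
  [set L' | NExt L L' /\ pretabular L'].

(* Main.v *)
Require Import Defs.
From HB Require Import structures.
From mathcomp Require Import all_boot.
From mathcomp Require Import boolp classical_sets functions cardinality.

(* All the logics below come from frames [garland x], x : nat -> bool, of depth 2:
   an infinite zigzag Low 0 < High 0 > Low 1 < High 1 > ... whose minimal points,
   except Low 0, lie below a common maximal point Hub, together with further
   maximal points that record the bits of x. Starting from {Hub} one defines every
   {Low n}, hence all the bits of x, and [garland_logic x] is the logic of the
   subalgebra generated by {Hub}. Conversely Hub is the only point that can reach
   many points by one step down followed by one step up, so {Hub} is definable,
   by a fixed formula, from any twenty disjoint nonempty sets. Consequently a logic
   that contains [garland_logic x] and is not contained in it proves that there are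
   no twenty disjoint nonempty sets; looking at its canonical model it is then the
   logic of a finite frame. So all the [garland_logic x] are pretabular, and they
   are pairwise distinct. The same argument shows that the pretabular extensions
   of the intersection of the [garland_logic x], x in S, are just these logics as
   soon as S is finite or, more generally, compact; the cardinals up to aleph_0
   are obtained with finite sets S and with a convergent sequence. *)

Set Implicit Arguments.
Unset Strict Implicit.
Unset Printing Implicit Defensive.

Local Open Scope classical_set_scope.
Local Open Scope card_scope.

(** * Semantics and canonical theories *)

Definition Neg a := Imp a Bot.
Definition And a b := Neg (Imp a (Neg b)).
Definition Or a b := Imp (Neg a) b.
Definition Dia a := Neg (Box (Neg a)).
Definition bigAnd := foldr And (Neg Bot).
Definition bigOr := foldr Or Bot.

Lemma sat_Neg (F : frame) (V : nat -> set F) w a :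
  sat V w (Neg a) <-> ~ sat V w a.
Proof. by []. Qed.

Lemma sat_And (F : frame) (V : nat -> set F) w a b :
  sat V w (And a b) <-> sat V w a /\ sat V w b.
Proof.
split=> [H|[Ha Hb] H]; last exact: H.
by apply: contrapT => nab; apply: H => Ha Hb; apply: nab.
Qed.

Lemma sat_Or (F : frame) (V : nat -> set F) w a b :
  sat V w (Or a b) <-> sat V w a \/ sat V w b.
Proof.
split=> [H|[Ha|Hb]] //=.
by case: (pselect (sat V w a)) => Ha; [left|right; apply: H].
Qed.

Lemma sat_Dia (F : frame) (V : nat -> set F) w a :
  sat V w (Dia a) <-> exists2 v, acc w v & sat V v a.
Proof.
split=> [H|[v wv va] H]; last exact: (H v).
by apply: contrapT => nv; apply: H => v wv va; apply: nv; exists v.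
Qed.

Lemma sat_bigAnd (T : eqType) (F : frame) (V : nat -> set F) w (f : T -> form) l :
  sat V w (bigAnd (map f l)) <-> forall i, i \in l -> sat V w (f i).
Proof.
elim: l => [|x l IH]; first by split=> // _ [].
rewrite [bigAnd _]/(And (f x) (bigAnd (map f l))) sat_And IH; split.
  by move=> [Hx Hl] i; rewrite inE => /orP[/eqP->//|/Hl].
move=> H; split=> [|i il]; apply: H; first exact: mem_head.
by rewrite inE il orbT.
Qed.

Lemma sat_bigOr (T : eqType) (F : frame) (V : nat -> set F) w (f : T -> form) l :
  sat V w (bigOr (map f l)) <-> exists2 i, i \in l & sat V w (f i).
Proof.
elim: l => [|x l IH]; first by split=> // -[].
rewrite [bigOr _]/(Or (f x) (bigOr (map f l))) sat_Or IH; split.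
  by move=> [Hx|[i il Hi]]; [exists x; rewrite ?mem_head | exists i; rewrite // inE il orbT].
by move=> [i]; rewrite inE => /orP[/eqP->|il] Hi; [left|right; exists i].
Qed.

Lemma sat_subst (F : frame) (V : nat -> set F) s a w :
  sat V w (subst s a) <-> sat (fun n => [set v | sat V v (s n)]) w a.
Proof.
elim: a w => //= [a IHa b IHb|a IHa|a IHa] w.
- by rewrite IHa IHb.
- by split=> H y wy; apply/IHa/H.
- by split=> -[y [wy ya]]; exists y; split=> //; apply/IHa.
Qed.

Lemma subst_comp s t a : subst s (subst t a) = subst (fun n => subst s (t n)) a.
Proof. by elim: a => //= [a -> b ->|a ->|a ->]. Qed.

Lemma subst_Var a : subst Var a = a.
Proof. by elim: a => //= [a -> b ->|a ->|a ->]. Qed.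

(** Back and forth conditions are needed along both [acc] and its converse, because [Past] looks
    backwards. *)
Lemma sat_bisim (F G : frame) (V : nat -> set F) (W : nat -> set G)
    (Z : F -> G -> Prop) :
  (forall n x y, Z x y -> V n x <-> W n y) ->
  (forall x y x', Z x y -> acc x x' -> exists2 y', acc y y' & Z x' y') ->
  (forall x y y', Z x y -> acc y y' -> exists2 x', acc x x' & Z x' y') ->
  (forall x y x', Z x y -> acc x' x -> exists2 y', acc y' y & Z x' y') ->
  (forall x y y', Z x y -> acc y' y -> exists2 x', acc x' x & Z x' y') ->
  forall a x y, Z x y -> sat V x a <-> sat W y a.
Proof.
move=> ZV Zf Zb Zpf Zpb; elim=> //= [a IHa b IHb|a IHa|a IHa] x y Zxy.

- by rewrite (IHa _ _ Zxy) (IHb _ _ Zxy).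
- split=> H z xz.
    by have [x' xx' Z'] := Zb _ _ _ Zxy xz; apply/(IHa _ _ Z')/H.
  by have [y' yy' Z'] := Zf _ _ _ Zxy xz; apply/(IHa _ _ Z')/H.
- split=> -[z [zx za]].
    by have [y' yy' Z'] := Zpf _ _ _ Zxy zx; exists y'; split=> //; apply/(IHa _ _ Z').
  by have [x' xx' Z'] := Zpb _ _ _ Zxy zx; exists x'; split=> //; apply/(IHa _ _ Z').
Qed.

Ltac taut := let v := fresh "v" in move=> v; rewrite /=;
  repeat match goal with |- context [truth_value v ?a] => case: (truth_value v a) end;
  repeat match goal with |- context [v ?a] => case: (v a) end;
  by [].

(** * Maximal consistent sets of a tense logic *)

Section Theories.
Variables (M : set form) (logicM : tense_logic M).

Let M_taut a : tautology a -> M a. Proof. by case: logicM => H _ _ _; apply: H. Qed.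
Let M_mp a b : M (Imp a b) -> M a -> M b. Proof. by case: logicM => _ H _ _; apply: H. Qed.
Let M_adj a b : M (Imp (Past a) b) <-> M (Imp a (Box b)). Proof. by case: logicM. Qed.

Lemma logic_trans a b c : M (Imp a b) -> M (Imp b c) -> M (Imp a c).
Proof.
move=> ab bc; apply: M_mp bc; apply: M_mp ab; apply: M_taut; taut.
Qed.

Lemma past_mono a b : M (Imp a b) -> M (Imp (Past a) (Past b)).
Proof. by move=> ab; apply/M_adj; apply: (logic_trans ab); apply/M_adj/M_taut; taut. Qed.

Lemma past_box a : M (Imp (Past (Box a)) a).
Proof. by apply/M_adj/M_taut; taut. Qed.

Lemma box_nec a : M a -> M (Box a).
Proof.
move=> Ma; have : M (Imp (Neg Bot) (Box a)).
  by apply/M_adj; apply: M_mp Ma; apply: M_taut; taut.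
by move/M_mp; apply; apply: M_taut; taut.
Qed.

Lemma box_K a b : M (Imp (Box (Imp a b)) (Imp (Box a) (Box b))).
Proof.
suff H : M (Imp (And (Box (Imp a b)) (Box a)) (Box b)).
  by apply: M_mp H; apply: M_taut; taut.
apply/M_adj; set X := And _ _.
have X1 : M (Imp (Past X) (Imp a b)).
  by apply: (logic_trans _ (past_box _)); apply: past_mono; apply: M_taut; rewrite /X; taut.
have X2 : M (Imp (Past X) a).
  by apply: (logic_trans _ (past_box _)); apply: past_mono; apply: M_taut; rewrite /X; taut.
by apply: M_mp X2; apply: M_mp X1; apply: M_taut; taut.
Qed.

Lemma past_or a b : M (Imp (Past (Or a b)) (Or (Past a) (Past b))).
Proof.
apply/M_adj.
have H1 : M (Imp a (Box (Or (Past a) (Past b)))) by apply/M_adj/M_taut; taut.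
have H2 : M (Imp b (Box (Or (Past a) (Past b)))) by apply/M_adj/M_taut; taut.
by apply: (M_mp (M_mp _ H1) H2); apply: M_taut; taut.
Qed.

Lemma past_bot : M (Neg (Past Bot)).
Proof. by apply/M_adj/M_taut; taut. Qed.

(** A local notion: closed under modus ponens but not under necessitation or substitution, as is the
    set of formulas true at one point. *)
Definition theory (T : set form) :=
  M `<=` T /\ forall a b, T (Imp a b) -> T a -> T b.

Definition mcs (T : set form) := theory T /\ forall a, T (Neg a) <-> ~ T a.

Lemma lindenbaum T a : theory T -> ~ T a -> exists G, [/\ mcs G, T `<=` G & ~ G a].
Proof.
move=> [MT Tmp] nTa.
(* Joining [T] to [X] makes the union of the empty chain admissible for Zorn's lemma. *)
pose P X := theory (T `|` X) /\ ~ (T `|` X) a.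
have [F FP Ftot|A [[[MA Amp] nAa] Amax]] := @Zorn_bigcup _ P.
  split; last first.
    by move=> [//|[X FX Xa]]; have [_] := FP X FX; apply; right.
  split=> [b Mb|b c]; first by left; apply: MT.
  have key X : F X -> (T `|` X) (Imp b c) -> (T `|` X) b ->
      (T `|` \bigcup_(Y in F) Y) c.
    move=> FX Xbc Xb; have [[_ Xmp] _] := FP X FX.
    by have [Tc|Xc] := Xmp _ _ Xbc Xb; [left|right; exists X].
  move=> [Tbc|[X FX Xbc]] [Tb|[Y FY Yb]].
  - by left; apply: (Tmp) Tbc Tb.
  - by apply: (key Y FY); [left|right].
  - by apply: (key X FX); [right|left].
  - have [XY|YX] := Ftot _ _ FX FY.
      by apply: (key Y FY); right=> //; apply: XY.
    by apply: (key X FX); right=> //; apply: YX.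
pose G := T `|` A; exists G; split=> //; last by move=> b Tb; left.
have Gtaut b : tautology b -> G b by move=> /M_taut /MA.
(* Otherwise the consequences of [b] over [G] would form a larger theory still avoiding [a]. *)
have ext b : ~ G b -> G (Imp b a).
  move=> nGb; apply: contrapT => nba.
  pose B := [set c | G (Imp b c)].
  have GB : G `<=` B.
    by move=> c Gc; apply: (Amp) Gc; apply: Gtaut; taut.
  have TB : T `|` B = B by apply/setUidPr => c Tc; apply: GB; left.
  apply: (Amax B).
    split=> [c Ac|BA]; first by apply: GB; right.
    by apply: nGb; right; apply: BA; apply: Gtaut; taut.
  split; rewrite TB //; split=> [c Mc|c d Bcd Bc]; first exact/GB/MA.
  apply: (Amp) Bc; apply: (Amp) Bcd; apply: Gtaut; taut.
split; first by [].
move=> b; split=> [Gnb Gb|nGb].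
  apply: nAa; apply: (Amp) (Amp _ _ Gnb Gb); apply: Gtaut; taut.
apply: contrapT => nGnb; apply: nAa.
apply: (Amp) (ext _ nGb); apply: (Amp) (ext _ nGnb); apply: Gtaut; taut.
Qed.

Lemma mcs_Imp G a b : mcs G -> G (Imp a b) <-> (G a -> G b).
Proof.
move=> [[MG Gmp] Gneg]; split=> [|H]; first exact: Gmp.
case: (pselect (G a)) => [Ga|/Gneg Gna].
  by apply: (Gmp) (H Ga); apply/MG/M_taut; taut.
by apply: (Gmp) Gna; apply/MG/M_taut; taut.
Qed.

Lemma mcs_Bot G : mcs G -> ~ G Bot.
Proof.
move=> [[MG Gmp] Gneg]; apply/Gneg; apply/MG/M_taut; taut.
Qed.

Lemma logic_theory : theory M. Proof. by split. Qed.

Definition mcs_acc (G D : set form) := forall a, G (Box a) -> D a.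

Lemma mcs_box G a : mcs G -> G (Box a) <-> forall D, mcs D -> mcs_acc G D -> D a.
Proof.
move=> mG; split=> [Ga D _|H]; first exact.
apply: contrapT => nGa.
have T0 : theory [set b | G (Box b)].
  case: mG => -[MG Gmp] _; split=> [b Mb|b c Gbc Gb]; first exact/MG/box_nec.
  by apply: (Gmp) Gb; apply: (Gmp) Gbc; apply/MG/box_K.
by have [D [mD GD nDa]] := lindenbaum T0 nGa; apply: nDa; apply: H.
Qed.

Lemma mcs_past G a : mcs G ->
  G (Past a) <-> exists D, [/\ mcs D, mcs_acc D G & D a].
Proof.
move=> mG; have [[MG Gmp] Gneg] := mG; split=> [Ga|[D [mD DG Da]]]; last first.
  apply: DG; have [[MD Dmp] _] := mD; apply: (Dmp) Da; apply/MD/M_adj/M_taut; taut.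
have Gmono b c : M (Imp b c) -> G (Past b) -> G (Past c).
  by move=> /past_mono /MG; apply: Gmp.
(* The formulas that, according to [G], no predecessor satisfying [a] refutes. A maximal extension
   of [T0] without [Neg a] is the required predecessor. *)
pose T0 := [set b | ~ G (Past (Neg (Imp a b)))].
have theoryT0 : theory T0.
  split=> [b Mb|b c Tbc Tb Gc].
    move/(Gmono _ Bot) => H; apply: (mcs_Bot mG).
    apply: (Gmp) (H _); first exact/MG/past_bot.
    by apply: M_mp Mb; apply: M_taut; taut.
  have : G (Past (Or (Neg (Imp a (Imp b c))) (Neg (Imp a b)))).
    by apply: (Gmono) Gc; apply: M_taut; taut.
  move/(Gmp _ _ (MG _ (past_or _ _))); move/(mcs_Imp _ _ mG) => H.
  by apply/Tb/H/(mcs_Imp _ _ mG).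
have nT0 : ~ T0 (Neg a).
  by apply; apply: (Gmono) Ga; apply: M_taut; taut.
have [D [mD T0D nDa]] := lindenbaum theoryT0 nT0.
exists D; split=> //; last first.
  by have [_ Dneg] := mD; apply: contrapT => /Dneg.
move=> b Db; apply: contrapT => nGb.
have : D (Neg (Box b)).
  apply: T0D => /(Gmono _ (Box b)) H; apply: nGb.
  by apply: (Gmp) (H _); [apply/MG/past_box|apply: M_taut; taut].
by have [_ Dneg] := mD; move/Dneg.
Qed.

End Theories.

(** * Tabularity from the absence of many disjoint sets *)

Definition Near a := Past (Dia a).
(** Three steps of down followed by up reach every vertex of a garland, so there [Ev] is the global
    existential modality. *)
Definition Ev a := Near (Near (Near a)).
(* [cell i] for varying [i] are pairwise disjoint whatever the valuation is. *)
Definition cell i := And (Var i) (bigAnd [seq Neg (Var j) | j <- iota 0 i]).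
Definition spread n := bigAnd [seq Ev (cell i) | i <- iota 0 n].

Lemma sat_cell (F : frame) (V : nat -> set F) w i :
  sat V w (cell i) <-> V i w /\ forall j, j < i -> ~ V j w.
Proof.
rewrite sat_And sat_bigAnd; split=> -[Vi H]; split=> // j.
  by move=> ji; apply: (H j); rewrite mem_iota.
by rewrite mem_iota => ji; apply: (H j).
Qed.

Lemma sat_spread (F : frame) (V : nat -> set F) w n :
  sat V w (spread n) <-> forall i, i < n -> sat V w (Ev (cell i)).
Proof.
rewrite sat_bigAnd; split=> H j jn; apply: H; first by rewrite mem_iota.
by move: jn; rewrite mem_iota.
Qed.

(** The connected component of a point, which is all that tense formulas can see from it. *)
Inductive linked (F : frame) : F -> F -> Prop :=
| linked_refl x : linked x x
| linked_acc x y z : acc x y -> linked y z -> linked x z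
| linked_acc_inv x y z : acc y x -> linked y z -> linked x z.

Lemma linked_trans (F : frame) (x y z : F) : linked x y -> linked y z -> linked x z.
Proof.
move=> xy; elim: xy z => // [u v w uv _ IH z wz|u v w uv _ IH z wz].
  exact: linked_acc uv (IH _ wz).
exact: linked_acc_inv uv (IH _ wz).
Qed.

(** If the distinct elements listed so far do not exhaust [A], one more is added; otherwise
    inverting the list numbers [A]. *)
Lemma few_or_many T (A : set T) (x0 : T) n :
  (exists g : nat -> T, (forall i, i < n -> A (g i)) /\
     (forall i j, i < n -> j < n -> g i = g j -> i = j)) \/
  (exists f : T -> nat, (forall x, A x -> f x < n) /\
     (forall x y, A x -> A y -> f x = f y -> x = y)).
Proof.
elim: n => [|n [[g [gA ginj]]|[f [fn finj]]]].
- by left; exists (fun=> x0).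
- case: (pselect (exists2 x, A x & forall i, i < n -> g i <> x)) => [[x Ax gx]|H].
    left; exists (fun i => if i < n then g i else x); split=> [i _|i j].
      by case: ifP => // /gA.
    rewrite !ltnS (leq_eqVlt i) (leq_eqVlt j) => /orP[/eqP->|li] /orP[/eqP->|lj] //.
    + by rewrite ltnn lj => /esym /gx; case.
    + by rewrite ltnn li => /gx; case.
    + by rewrite li lj => /ginj; apply.
  right.
  have /choice[f fP] : forall x, exists i, A x -> i < n /\ g i = x.
    move=> x; case: (pselect (A x)) => [Ax|nAx]; last by exists 0.
    apply: contrapT => nx; apply: H; exists x => // i li gi.
    by apply: nx; exists i.
  exists f; split=> [x /fP[/ltnW]|x y /fP[_ gx] /fP[_ gy] fxy] //.
  by rewrite -gx -gy fxy.
- by right; exists f; split=> // x /fn /ltnW.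
Qed.

(** * The canonical model and the tabularity criterion *)

Section TabularityCriterion.
Variables (M : set form) (logicM : tense_logic M) (consM : consistent M).

Lemma canon_inhabited : inhabited {G : set form | mcs M G}.
Proof.
have [G [mG _ _]] := lindenbaum logicM (logic_theory logicM) consM.
by constructor; exists G.
Qed.

Definition canon : frame :=
  @Frame {G : set form | mcs M G} (fun G D => mcs_acc (sval G) (sval D)) canon_inhabited.

Definition canon_val (s : nat -> form) (n : nat) : set canon := [set G | sval G (s n)].

(** The truth lemma for valuations given by substitutions: closure of [M] under substitution makes
    [M] sound for these, whereas it need not be valid on the whole canonical frame. *)
Lemma canon_truth s a (G : canon) : sat (canon_val s) G a <-> sval G (subst s a).
Proof.
elim: a G => [n||a IHa b IHb|a IHa|a IHa] G //=.
- by split=> // /(mcs_Bot logicM (svalP G)).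
- by rewrite (mcs_Imp logicM _ _ (svalP G)) IHa IHb.
- rewrite (mcs_box logicM _ (svalP G)); split=> H D.
    by move=> mD GD; exact: (IHa (exist _ D mD)).1 (H (exist _ D mD) GD).
  by move=> GD; apply/IHa; apply: H GD; apply: svalP.
- rewrite (mcs_past logicM _ (svalP G)); split=> -[D].
    by move=> [DG /IHa Da]; exists (sval D); split=> //; apply: svalP.
  by move=> [mD DG Da]; exists (exist _ D mD); split=> //; apply/IHa.
Qed.

Definition cval := canon_val Var.

Lemma canon_mem a (G : canon) : sat cval G a <-> sval G a.
Proof. by rewrite canon_truth subst_Var. Qed.

Lemma canon_sound a s (G : canon) : M a -> sat (canon_val s) G a.
Proof.
move=> Ma; rewrite canon_truth; have [[MG _] _] := svalP G; apply: MG.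
by case: logicM => _ _ Hs _; apply: Hs.
Qed.

Lemma canon_complete a : (forall G : canon, sat cval G a) -> M a.
Proof.
move=> H; apply: contrapT => nMa.
have [G [mG _ nGa]] := lindenbaum logicM (logic_theory logicM) nMa.
by apply: nGa; apply/(canon_mem a (exist _ G mG)).
Qed.

Lemma canon_sep (G D : canon) : G <> D -> exists2 a, sat cval G a & ~ sat cval D a.
Proof.
move=> GD; apply: contrapT => H; apply: GD.
have GsD a : sval G a -> sval D a.
  move=> Ga; apply: contrapT => nDa; apply: H; exists a; first exact/canon_mem.
  by move/canon_mem.
have : sval G = sval D.
  apply/seteqP; split=> a; first exact: GsD.
  move=> Da; apply: contrapT; have [_ Gneg] := svalP G; move=> /Gneg /GsD.
  by have [_ Dneg] := svalP D; move/Dneg.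
case: G D {H GsD} => [G mG] [D mD] /= E; subst D.
by congr exist; apply: Prop_irrelevance.
Qed.

Lemma canon_sep_list (G : canon) n (g : nat -> canon) : exists2 a, sat cval G a &
  forall i, i < n -> g i <> G -> ~ sat cval (g i) a.
Proof.
elim: n => [|n [a Ga IH]]; first by exists (Neg Bot).
case: (pselect (g n = G)) => [gn|/nesym/canon_sep[b Gb nb]].
  exists a => // i; rewrite ltnS leq_eqVlt => /orP[/eqP->//|]; exact: IH.
exists (And a b); first exact/sat_And.
move=> i; rewrite ltnS leq_eqVlt => /orP[/eqP->|li] giG /sat_And[ga gb] //.
exact: (IH i).
Qed.

(** By induction on the list, the formula for the earlier points is corrected at [g n] by a formula
    separating [g n] from them. Thus on finitely many points every valuation is definable. *)
Lemma canon_definable n (g : nat -> canon) (X : set canon) : exists a,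
  forall i, i < n -> sat cval (g i) a <-> X (g i).
Proof.
elim: n => [|n [a IH]]; first by exists Bot.
have [b gb nb] := canon_sep_list (g n) n g.
case: (pselect (X (g n))) => Xn.
  exists (Or a b) => i; rewrite ltnS leq_eqVlt sat_Or => /orP[/eqP->|li].
    by split=> // _; right.
  rewrite (IH i li); split=> [[//|gib]|]; last by left.
  case: (pselect (g i = g n)) => [->//|ne]; by have := nb i li ne.
exists (And a (Neg b)) => i; rewrite ltnS leq_eqVlt sat_And sat_Neg => /orP[/eqP->|li].
  by split=> // -[_ /(_ gb)].
rewrite (IH i li); split=> [[]//|Xi]; split=> //; apply: nb => // E.
by apply: Xn; rewrite -E.
Qed.

Hypothesis Ev_refl : forall a, M (Imp a (Ev a)).
Hypothesis Ev_dia : forall a, M (Imp (Dia (Ev a)) (Ev a)).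
Hypothesis Ev_past : forall a, M (Imp (Past (Ev a)) (Ev a)).

(** The three hypotheses introduce [Ev a] at the end of the path and carry it back along each link
    in either direction. *)
Lemma linked_Ev (G D : canon) a : linked G D -> sat cval D a -> sat cval G (Ev a).
Proof.
elim=> [x|x y z xy _ IH|x y z yx _ IH] za.
- exact: (canon_sound Var x (Ev_refl a)).
- apply: (canon_sound Var x (Ev_dia a) : sat cval x (Dia (Ev a)) -> _).
  by apply/sat_Dia; exists y => //; exact: IH.
- apply: (canon_sound Var x (Ev_past a) : sat cval x (Past (Ev a)) -> _).
  by exists y; split=> //; apply: IH.
Qed.

(** * A finite frame collecting all components of bounded size *)

Section Codes.
Variable n : nat.

Local Notation code_type := ({set 'I_n} * {set 'I_n * 'I_n})%type.

(** An isomorphic copy, on a subset of ['I_n], of the component of [G] as numbered by [f]. There may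
    be infinitely many components, but only finitely many codes. *)
Definition code (G : canon) (f : canon -> nat) : code_type :=
  ([set i : 'I_n | `[< exists2 D, linked G D & f D = i >]],
   [set p : 'I_n * 'I_n | `[< exists D E, [/\ linked G D, linked G E, acc D E,
                                f D = p.1 & f E = p.2] >]])%SET.

Definition injects (G : canon) (f : canon -> nat) :=
  (forall D, linked G D -> f D < n) /\
  (forall D E, linked G D -> linked G E -> f D = f E -> D = E).

Definition good (t : code_type * 'I_n) : Prop :=
  (exists G f, injects G f /\ t.1 = code G f) /\ t.2 \in t.1.1.

Definition code_world := {t : code_type * 'I_n | `[< good t >]}.

(** Requiring equal codes makes the frame the disjoint union of the coded components. *)
Definition code_acc (v w : code_world) :=
  (val v).1 = (val w).1 /\ ((val v).2, (val w).2) \in (val v).1.2.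

Definition represents (G : canon) f (D : canon) (w : code_world) :=
  [/\ linked G D, (val w).1 = code G f & (val w).2 = f D :> nat].

Lemma represented G f D : injects G f -> linked G D -> exists w, represents G f D w.
Proof.
move=> If GD; have fD := If.1 _ GD.
have gt : good (code G f, Ordinal fD).
  by split; [exists G, f | rewrite inE; apply/asboolP; exists D].
by exists (exist (fun t => is_true `[< good t >]) (code G f, Ordinal fD) (asboolT gt)).
Qed.

Lemma representing G f w : injects G f -> (val w).1 = code G f ->
  exists D, represents G f D w.
Proof.
move=> If E; have /asboolP[_] := valP w; rewrite E inE => /asboolP[D GD fD].
by exists D.
Qed.

Lemma represents_acc G f D E v w : injects G f ->
  represents G f D v -> represents G f E w -> acc D E <-> code_acc v w.
Proof.
move=> If [GD v1 v2] [GE w1 w2]; rewrite /code_acc v1 w1 inE; split=> [DE|[_]].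
  by split=> //; apply/asboolP; exists D, E.
move=> /asboolP /= [D' [E' [GD' GE' DE']]]; rewrite v2 w2.
by move=> /If.2 <- // /If.2 <- //.
Qed.

Variable W0 : inhabited code_world.
Definition code_frame : frame := @Frame code_world code_acc W0.

Lemma code_bisim G f (V : nat -> set canon) (W : nat -> set code_frame) :
  injects G f ->
  (forall m D w, represents G f D w -> V m D <-> W m w) ->
  forall a D w, represents G f D w -> sat V D a <-> sat W w a.
Proof.
move=> If VW.
apply: (@sat_bisim canon code_frame V W (@represents G f)) => [m D w|D w E|D w v|D w E|D w v] Dw.
- exact: VW.
- move=> DE; have GE : linked G E.
    case: Dw => GD _ _; apply: linked_trans GD _.
    exact: linked_acc DE (linked_refl _).
  have [v Ev] := represented If GE; exists v => //.
  exact/(represents_acc If Dw Ev).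
- move=> wv; case: (Dw) => _ w1 _; have v1 : (val v).1 = code G f by rewrite -w1 wv.1.
  have [E Ev] := representing If v1; exists E => //.
  exact/(represents_acc If Dw Ev).
- move=> DE; have GE : linked G E.
    case: Dw => GD _ _; apply: linked_trans GD _.
    exact: linked_acc_inv DE (linked_refl _).
  have [v Ev] := represented If GE; exists v => //.
  exact/(represents_acc If Ev Dw).
- move=> wv; case: (Dw) => _ w1 _; have v1 : (val v).1 = code G f by rewrite -w1 wv.1.
  have [E Ev] := representing If v1; exists E => //.
  exact/(represents_acc If Ev Dw).
Qed.

End Codes.

(** A component with [n] distinct points would satisfy [spread n] under a substitution isolating
    them. So all components are small, and their finitely many codes form a finite frame for [M]. *)
Lemma spread_tabular n : M (Neg (spread n)) -> tabular M.
Proof.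
move=> Mn.
have inj G : exists f, injects n G f.
  have [[g [gG ginj]]|[f fP]] := few_or_many [set D | linked G D] G n; last by exists f.
  have /choice[s sP] : forall j, exists a, forall i, i < n -> sat cval (g i) a <-> g i = g j.
    by move=> j; apply: (canon_definable n g (fun D => D = g j)).
  have nG : ~ sat (canon_val s) G (spread n) := canon_sound s G Mn.
  case: nG; apply/sat_spread => i li; apply/canon_truth/canon_mem.
  apply: (linked_Ev (a := subst s (cell i)) (gG i li)).
  apply/canon_mem/canon_truth/sat_cell; split=> [|j ji]; first exact/canon_mem/sP.
  have lj := ltn_trans ji li.
  by move=> /canon_mem/(sP j i li) /(ginj _ _ li lj) E; rewrite E ltnn in ji.
have W0 : inhabited (code_world n).
  have [G] := canon_inhabited; have [f If] := inj G.
  by have [w _] := represented If (linked_refl (G : canon)).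
exists (code_frame W0); split; first exact: finite_finset.
apply/seteqP; split=> a.
  move=> Ma W w; have /asboolP[[G [f [If w1]]] _] := valP w.
  have [D Dw] := representing If w1.
  (* [g] inverts the numbering [f] of the component, with default value [G] outside its range. *)
  have /choice[g gP] : forall i, exists D, (exists2 E, linked G E & f E = i) ->
      linked G D /\ f D = i.
    move=> i; case: (pselect (exists2 E, linked G E & f E = i)) => [[E GE fE]|nE].
      by exists E.
    by exists G.
  (* An arbitrary valuation [W] of the finite frame is pulled back to a definable one on the
     component, where [M] is sound. *)
  have /choice[s sP] : forall m, exists b, forall i, i < n ->
      sat cval (g i) b <-> exists2 v, represents G f (g i) v & W m v.
    move=> m; exact: (canon_definable n g (fun E => exists2 v, represents G f E v & W m v)).
  have VW m E v : represents G f E v -> canon_val s m E <-> W m v.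
    move=> Ev; have [GE v1 v2] := Ev.
    have gE : g (f E) = E.
      have [GgE fgE] : linked G (g (f E)) /\ f (g (f E)) = f E by apply: gP; exists E.
      exact: (If.2).
    have := sP m (f E) (If.1 _ GE); rewrite canon_mem /= /canon_val gE /= => ->.
    split=> [[v' [_ v1' v2'] Wv']|Wv]; last by exists v.
    suff -> : v = v' by [].
    apply: val_inj; rewrite [LHS]surjective_pairing [RHS]surjective_pairing v1 v1'.
    by congr pair; apply: val_inj; rewrite /= v2 v2'.
  apply/(@code_bisim n W0 G f (canon_val s) W If VW a D w Dw).
  exact: canon_sound.
(* Conversely, the canonical valuation on the component of [G] is transported to its code. *)
move=> La; apply: canon_complete => G; have [f If] := inj G.
have [w Gw] := represented If (linked_refl G).
pose W m : set (code_frame W0) := [set v | exists2 E, represents G f E v & cval m E].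
have VW m D v : represents G f D v -> cval m D <-> W m v.
  move=> Dv; split=> [Dm|[E Ev Em]]; first by exists D.
  suff -> : D = E by [].
  have [GD _ fD] := Dv; have [GE _ fE] := Ev.
  by apply: (If.2) => //; rewrite -fD -fE.
by apply/(@code_bisim n W0 G f cval W If VW a G w Gw); exact: La.
Qed.

End TabularityCriterion.

(** * Garlands *)

Lemma sat_Near (F : frame) (V : nat -> set F) w a :
  sat V w (Near a) <-> exists v u, [/\ acc v w, acc v u & sat V u a].
Proof.
split=> [[v [vw /sat_Dia[u vu ua]]]|[v [u [vw vu ua]]]]; first by exists v, u.
by exists v; split=> //; apply/sat_Dia; exists u.
Qed.

(** The twenty cells are grouped in ten pairs so that a point missing a single vertex is still near
    every pair. *)
Definition hub :=
  bigAnd [seq Near (Or (cell i) (cell (10 + i))) | i <- iota 0 10].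

Inductive vertex := Hub | Low of nat | High of nat & bool.
Fact vertex_hasDecEq : hasDecEq vertex. Proof. exact: gen_eqMixin. Qed.
HB.instance Definition _ := vertex_hasDecEq.

Section Garland.
Variable x : nat -> bool.

(* [High n true] loses its lower neighbour [Low n] when [x n] holds; otherwise it
   is a duplicate of [High n false]. *)
Definition below (u v : vertex) : Prop :=
  match u, v with
  | Low m, Hub => 0 < m
  | Low m, High n b => m = n.+1 \/ (m = n /\ ~~ (b && x n))
  | _, _ => False
  end.

Definition garland : frame :=
  @Frame vertex (fun u v => u = v \/ below u v) (inhabits Hub).

Implicit Types u v w : garland.

Lemma garland_trans u v w : acc u v -> acc v w -> acc u w.
Proof.
move=> [->//|uv] [<-|vw]; first by right.
by right; case: u v w uv vw => [|?|? ?] [|?|? ?].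
Qed.

Definition near_pt u v := exists2 w, acc w u & acc w v.

Lemma near_pt_refl u : near_pt u u.
Proof. by exists u; left. Qed.

Lemma near_C w : w <> Low 0 -> near_pt Hub w.
Proof.
case: w => [|[//|m]|m b] _; first exact: near_pt_refl.
  by exists (Low m.+1); [right|left].
by exists (Low m.+1); right=> //; left.
Qed.

(** [Low 0] is minimal and does not lie below [Hub]. *)
Lemma not_near_C_A0 : ~ near_pt Hub (Low 0).
Proof. by move=> [[|m|m b]] [] //= H [] // []; case: m H. Qed.

Lemma near_sym u v : near_pt u v -> near_pt v u.
Proof. by move=> [w wu wv]; exists w. Qed.

(** A common upper bound for what is near [Low n] or [High n b]. Only its length nine, less than
    ten, matters; for [n = 0] entries repeat. *)
Definition nbhd n : seq vertex :=
  [:: Hub; Low n; Low n.+1; High n.-1 true; High n.-1 false; High n true; High n false;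
      High n.+1 true; High n.+1 false].

Lemma near_nbhd u : u <> Hub -> exists n, forall v, near_pt u v -> v \in nbhd n.
Proof.
have AB m v : acc (Low m : garland) v -> v \in [:: Hub; Low m; High m.-1 true; High m.-1 false; High m true; High m false].
  case: v => [|n|n b]; rewrite !inE ?eqxx //.
    by case=> // -[->]; rewrite !eqxx /= !orbT.
  by case=> // -[->|[-> _]] /=; case: b; rewrite !eqxx /= !orbT.
case: u => // [n|n b] _; exists n => v [w wu wv].
  have E : w = Low n by case: w wu {wv} => [|?|? ?] [].
  move: wv; rewrite E => /AB; rewrite !inE.
  by do ?[case/orP]=> /eqP->; rewrite !eqxx /= ?orbT.
case: wu wv => [->|].
  case=> [<-|//]; rewrite !inE; case: b => //; by rewrite !eqxx /= ?orbT.
case: w => // m /= [->|[-> _]] /AB; rewrite !inE;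
by do ?[case/orP]=> /eqP->; rewrite !eqxx /= ?orbT.
Qed.

Lemma sat_Near_garland (V : nat -> set garland) w a :
  sat V w (Near a) <-> exists2 v, near_pt w v & sat V v a.
Proof.
rewrite sat_Near; split=> [[v [u [vw vu ua]]]|[u [v vw vu] ua]]; last by exists v, u.
by exists u => //; exists v.
Qed.

(** Every vertex but [Low 0] is one step from [Hub], and [Low 0] is two steps from it through
    [High 0 false]. A path from [Low 0] to itself can stay there. *)
Lemma near3 u v : exists s t, [/\ near_pt u s, near_pt s t & near_pt t v].
Proof.
have A0 : near_pt (Low 0) (High 0 false) by exists (Low 0); [left|right; right].
case: (eqVneq u (Low 0)) => [->|/eqP/near_C/near_sym uC]; case: (eqVneq v (Low 0)) => [->|/eqP/near_C Cv].
- by exists (Low 0), (Low 0); split; apply: near_pt_refl.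
- by exists (High 0 false), Hub; split=> //; apply/near_sym/near_C.
- by exists Hub, (High 0 false); split=> //; [apply: near_C|apply: near_sym].
- by exists Hub, Hub; split=> //; apply: near_pt_refl.
Qed.

Lemma sat_Ev_garland (V : nat -> set garland) w a :
  sat V w (Ev a) <-> exists v, sat V v a.
Proof.
split=> [/sat_Near_garland[? _ /sat_Near_garland[? _ /sat_Near_garland[v _ va]]]|[v va]].
  by exists v.
have [s [t [ws st tv]]] := near3 w v.
apply/sat_Near_garland; exists s => //; apply/sat_Near_garland; exists t => //.
by apply/sat_Near_garland; exists v.
Qed.

Lemma cell_inj (V : nat -> set garland) w i j :
  sat V w (cell i) -> sat V w (cell j) -> i = j.
Proof.
move=> /sat_cell[Vi Hi] /sat_cell[Vj Hj]; case: (ltngtP i j) => // H.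
  by have := Hj _ H.
by have := Hi _ H.
Qed.

(* Any two vertices include one that is near the hub, whereas at most nine
   vertices are near any other vertex: this is where [hub] comes from. *)
Lemma sat_hub (V : nat -> set garland) w v :
  sat V w (spread 20) -> sat V v hub <-> v = Hub.
Proof.
move=> /sat_spread H.
have /choice[p pP] : forall i, exists u, i < 20 -> sat V u (cell i).
  move=> i; case: (ltnP i 20) => [/H/sat_Ev_garland[u ui]|_]; last by exists Hub.
  by exists u.
rewrite sat_bigAnd; split=> [Hv|-> i].
  apply: contrapT => /near_nbhd[n nP].
  have /choice[q qP] : forall i, exists u, i < 10 ->
      u \in nbhd n /\ sat V u (Or (cell i) (cell (10 + i))).
    move=> i; case: (ltnP i 10) => [li|_]; last by exists Hub.
    have := Hv i; rewrite mem_iota => /(_ li) /sat_Near_garland[u /nP vu ui].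
    by exists u.
  (* The pairs of cells are disjoint, so the ten witnesses are distinct vertices among at most
     nine. *)
  have : uniq [seq q i | i <- iota 0 10].
    rewrite map_inj_in_uniq ?iota_uniq // => i j.
    rewrite !mem_iota /= !add0n => li lj E; have [_ +] := qP i li; have [_] := qP j lj.
    rewrite -E !sat_Or => -[|] Hj [|] Hi; have := cell_inj Hi Hj => // ij.
    - by rewrite -ij ltnNge leq_addr in lj.
    - by rewrite ij ltnNge leq_addr in li.
    - by apply: (@addnI 10).
  move/(@uniq_leq_size _ _ (nbhd n)); rewrite size_map size_iota.
  suff sub : {subset [seq q i | i <- iota 0 10] <= nbhd n} by move/(_ sub).
  by move=> _ /mapP[i + ->]; rewrite mem_iota => /= li; have [] := qP i li.
rewrite mem_iota => li'; have {li'} li : i < 10 := li'; apply/sat_Near_garland.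
have l1 : i < 20 by apply: leq_trans li _.
have l2 : 10 + i < 20 by rewrite -[20]/(10 + 10) ltn_add2l.
(* [Low 0], the one vertex not near the hub, cannot lie in both [cell i] and [cell (10 + i)]. *)
case: (pselect (p i = Low 0)) => [pi|/near_C pi].
  exists (p (10 + i)); last by apply/sat_Or; right; apply: pP.
  apply: near_C => pi'; have := pP _ l1; rewrite pi -pi' => /cell_inj /(_ (pP _ l2)).
  by move/eqP; rewrite -[X in X == _]add0n eqn_add2r.
by exists (p i) => //; apply/sat_Or; left; apply: pP.
Qed.

End Garland.

(** * The logic of the sets definable from the hub *)

(** With every variable denoting [{Hub}], formulas denote exactly the members of the subalgebra
    generated by [{Hub}]; substitutions then range over all valuations in it. *)
Definition hub_val x (n : nat) : set (garland x) := [set Hub : garland x].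
Arguments hub_val : clear implicits.

Definition garland_logic x : set form :=
  [set a | forall s (w : garland x), sat (hub_val x) w (subst s a)].

Lemma garland_logic_tense x : tense_logic (garland_logic x).
Proof.
split=> [a ta s w|a b Lab La s w|s a La t w|a b].
- have E v : truth_value (fun c => `[<sat (hub_val x) w (subst s c)>]) v =
      `[< sat (hub_val x) w (subst s v) >].
    elim: v => //= [|b -> c ->]; first by apply/esym/asboolPn.
    by rewrite -asbool_imply.
  by apply/asboolP; rewrite -E.
- exact: Lab (La s w).
- by rewrite subst_comp; exact: La.
- split=> H s w /= => [wa v wv|[v [vw va]]]; first by apply: (H s v); exists w.
  exact: (H s v).
Qed.

Lemma Log_garland_logic x : Log (garland x) `<=` garland_logic x.
Proof. by move=> a La s w; apply/sat_subst/La. Qed.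

Lemma garland_logic_consistent x : consistent (garland_logic x).
Proof. by move/(_ Var (Hub : garland x)). Qed.

(** * Defining the vertices and the bits from the hub *)

Section Definability.
Variable x : nat -> bool.

(* [Low n.+1] is the vertex other than [Low n.-1] and [Low n] that lies below an
   upper neighbour of [Low n] other than the hub. *)
Definition next_pos p q := And (And (Dia (And (Past q) (Neg (Var 0)))) (Neg (Past q))) (Neg p).
(** The recursion needs the two preceding vertices. It starts from [Low 0], the only vertex not near
    the hub, with [Bot] for its missing predecessor. *)
Fixpoint pos_pair n := if n is m.+1 then
  ((pos_pair m).2, next_pos (pos_pair m).1 (pos_pair m).2) else (Bot, Neg (Near (Var 0))).
Definition pos n := (pos_pair n).2.

Lemma sat_pos_pair n w : (sat (hub_val x) w (pos_pair n).1 <-> 0 < n /\ w = Low n.-1) /\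
  (sat (hub_val x) w (pos_pair n).2 <-> w = Low n).
Proof.
elim: n w => [|n IH] w.
  split; first by split=> // -[].
  rewrite [(pos_pair 0).2]/(Neg (Near (Var 0))) sat_Neg sat_Near_garland; split=> [H|-> [v nv vC]]; last first.
    by apply: (@not_near_C_A0 x); move: nv; rewrite (vC : v = Hub) => /near_sym.
  apply: contrapT => /near_C /near_sym wC; apply: H.
  by exists Hub.
split; first by rewrite [(pos_pair n.+1).1]/(pos_pair n).2 (IH w).2; split=> [->//|[_ ->]].
rewrite [(pos_pair n.+1).2]/(next_pos (pos_pair n).1 (pos_pair n).2).
rewrite !sat_And sat_Dia !sat_Neg (IH w).1.
have P u : sat (hub_val x) u (Past (pos_pair n).2) <-> acc (Low n : garland x) u.
  by split=> [[v [vu /(IH v).2 <-//]]|nu]; exists (Low n); split=> //; apply/(IH _).2.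
rewrite P; split=> [[[[u wu /sat_And[/P nu uC]] nw] nw']|->].
  case: w wu nw nw' => [|m|m b] wu nw nw'.
  - by case: wu uC => [<-|//] []; reflexivity.
  - case: u wu nu uC => [|j|j b] [E|mj] nu uC //; first by case: uC.
      by case: nw; rewrite E.
    case: nu mj => //= -[nj|[nj _]] [mj|[mj _]].
    (* Both [n] and [m] are [j] or [j.+1]. Equality and [m = n.-1] are excluded, which leaves
       [m = n.+1]. *)
    + by case: nw; left; rewrite nj mj.
    + by case: nw'; rewrite nj -mj.
    + by rewrite nj mj.
    + by case: nw; left; rewrite nj mj.
  - by case: wu nu nw => [->|].
split; last by case=> n0 [E]; have := leq_pred n; rewrite -E ltnn.
split; last by case=> // -[E]; case: (n_Sn n E).
(* Unlike [High n true], this vertex lies above both [Low n] and [Low n.+1] whatever the bit. *)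
exists (High n false); first by right; left.
by apply/sat_And; split=> //; apply/P; right; right.
Qed.

Lemma sat_pos n w : sat (hub_val x) w (pos n) <-> w = Low n.
Proof. exact: (sat_pos_pair n w).2. Qed.

(** Under [pos] the cells become the singletons [{Low i}]: any number of disjoint nonempty sets is
    definable from the hub. *)
Lemma sat_spread_pos n w : sat (hub_val x) w (subst pos (spread n)).
Proof.
apply/sat_subst/sat_spread => i _; apply/sat_Ev_garland; exists (Low i).
apply/sat_cell; split=> [|j ji]; first exact/sat_pos.
by move/sat_pos => -[E]; rewrite E ltnn in ji.
Qed.

(** Describes [High n true] after the loss of [Low n]. Excluding [Low n.+2] from below rules out the
    vertices [High n.+1 b]. *)
Definition bit n := And (And (Past (pos n.+1)) (Neg (Past (pos n))))
  (And (Neg (Past (pos n.+2))) (And (Neg (Var 0)) (Neg (pos n.+1)))).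

Lemma sat_bit n : (exists w, sat (hub_val x) w (bit n)) <-> x n.
Proof.
have P m u : sat (hub_val x) u (Past (pos m)) <-> acc (Low m : garland x) u.
  by split=> [[v [vu /sat_pos <-//]]|nu]; exists (Low m); split=> //; apply/sat_pos.
have {}P w : sat (hub_val x) w (bit n) <-> [/\ acc (Low n.+1 : garland x) w,
    ~ acc (Low n : garland x) w, ~ acc (Low n.+2 : garland x) w, w <> Hub & w <> Low n.+1].
  rewrite /bit; split.
    move=> /sat_And[/sat_And[/P a1 a0] /sat_And[a2 /sat_And[nC na]]].
    by split=> // [/(P _ _).2|/(P _ _).2|/(sat_pos _ _).2].
  move=> [a1 a0 a2 nC na]; apply/sat_And; split; apply/sat_And; split; first exact/P.
  - by move=> H; apply/a0/P.
  - by move=> H; apply/a2/P.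
  - by apply/sat_And; split=> // H; apply/na/sat_pos.
split=> [[w /P]|xn]; last first.
  exists (High n true); apply/P; split=> //=.
  - by right; left.
  - by case=> // -[E|[]]; [case: (n_Sn n E)|rewrite xn].
  - by case=> // -[[E]|[E _]]; [case: (n_Sn n)|have := leqnSn n.+1; rewrite E ltnn].
case: w => [|j|j b] [a1 a0 a2 nC na].
- by case: nC.
- by case: a1 => // E; case: na.
- case: a1 => // -[[E]|[E _]]; last by case: a2; right; left; rewrite E.
  apply: contrapT => nx; apply: a0; right; right; split=> //.
  by rewrite -E (negbTE (introN idP nx)) andbF.
Qed.

End Definability.

(** The antecedent forces [hub] to denote [{Hub}], so the consequent reads [bit n] as under
    [hub_val], whatever the valuation. *)
Definition bit_formula n := Imp (spread 20) (Ev (subst (fun=> hub) (bit n))).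

Lemma sat_subst_hub x (V : nat -> set (garland x)) w v a : sat V w (spread 20) ->
  sat V v (subst (fun=> hub) a) <-> sat (hub_val x) v a.
Proof.
move=> sp; rewrite sat_subst; suff -> : (fun=> [set v | sat V v hub]) = hub_val x by [].
by apply/funext => n; apply/seteqP; split=> u /(sat_hub _ sp).
Qed.

Lemma garland_logic_bit x n : garland_logic x (bit_formula n) <-> x n.
Proof.
split=> [/(_ pos (Hub : garland x)) H|xn].
  have sp := sat_spread_pos 20 (Hub : garland x).
  have /sat_subst/sat_Ev_garland[v] :
    sat (hub_val x) Hub (subst pos (Ev (subst (fun=> hub) (bit n)))) := H sp.
  move/sat_subst: sp => /sat_subst_hub E /E vb.
  by apply/sat_bit; exists v.
apply: Log_garland_logic => V w sp.
apply: (sat_Ev_garland V w (subst (fun=> hub) (bit n))).2.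
have [v vb] := (sat_bit x n).2 xn.
by exists v; apply/(sat_subst_hub _ _ sp).
Qed.

Lemma garland_logic_inj : injective garland_logic.
Proof.
move=> x y E; apply/funext => n; apply/idP/idP => /garland_logic_bit;
by rewrite (E, esym E) => /garland_logic_bit.
Qed.

(** By the pigeonhole principle a frame with at most [n] points validates [Neg (spread n.+1)], which
    [pos] refutes in the garland. *)
Lemma garland_logic_not_tabular x : ~ tabular (garland_logic x).
Proof.
move=> [G [/finite_set_leP[n /pcard_leP/injfunPex[f fn finj]] E]].
suff : garland_logic x (Neg (spread n.+1)).
  move/(_ pos (Hub : garland x)) => H.
  exact: H (sat_spread_pos n.+1 (Hub : garland x)).
rewrite E => V w; apply/sat_Neg => /sat_spread H.
have /choice[g gP] : forall i, exists u, i < n.+1 -> sat V u (cell i).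
  move=> i; case: (ltnP i n.+1) => [/H|_]; last by exists w.
  by move=> /sat_Near[_ [? [_ _ /sat_Near[_ [? [_ _ /sat_Near[_ [u [_ _ ui]]]]]]]]]; exists u.
have : uniq [seq f (g i) | i <- iota 0 n.+1].
  rewrite map_inj_in_uniq ?iota_uniq // => i j; rewrite !mem_iota => li lj.
  move=> /finj; rewrite !in_setT => /(_ isT isT) gij.
  have /sat_cell[Vi Hi] := gP i li; have := gP j lj; rewrite -gij => /sat_cell[Vj Hj].
  case: (ltngtP i j) => // ij; [by case: (Hj _ ij)|by case: (Hi _ ij)].
move/(@uniq_leq_size _ _ (iota 0 n)); rewrite size_map !size_iota ltnn.
suff sub : {subset [seq f (g i) | i <- iota 0 n.+1] <= iota 0 n} by move/(_ sub).
by move=> _ /mapP[i _ ->]; rewrite mem_iota; apply: fn.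
Qed.

(** * Continuity in the sequence of bits *)

Definition same_or_far k n m := n = m \/ (k < n /\ k < m).

(** A bounded bisimulation: vertices of the same kind with indices beyond [k] are not
    distinguished. *)
Definition alike k (u v : vertex) : Prop :=
  match u, v with
  | Hub, Hub => True
  | Low n, Low m => same_or_far k n m
  | High n b, High m c => (n = m /\ b = c) \/ (k < n /\ k < m)
  | _, _ => False
  end.

Lemma alike_refl k u : alike k u u.
Proof. by case: u => [|n|n b] //=; left. Qed.

Lemma alike_sym k u v : alike k u v -> alike k v u.
Proof.
by case: u v => [|n|n b] [|m|m c] //= [E|[kn km]]; [left|right|left; case: E|right].
Qed.

Lemma alike_leq k l u v : k <= l -> alike l u v -> alike k u v.
Proof.
move=> kl; have H n m : l < n /\ l < m -> k < n /\ k < m.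
  by move=> [ln lm]; split; apply: leq_ltn_trans kl _.
by case: u v => [|n|n b] [|m|m c] //= [E|/H]; [left|right|left|right].
Qed.

(** A step between [Low] and [High] moves the index by at most one, so one level of likeness is
    lost. Where the bits may differ, a vertex [High _ false] serves, as its lower neighbours do not
    depend on them. *)
Lemma alike_up x y k u v u' : (forall i, i <= k.+1 -> x i = y i) ->
  alike k.+1 u v -> acc (u : garland x) u' ->
  exists2 v', acc (v : garland y) v' & alike k u' v'.
Proof.
move=> xy uv [<-|uu'].
  by exists v; [left|apply: alike_leq uv].
case: u uu' uv => // n; case: u' => // [n0|j b jn]; case: v => // m.
  move=> nm; exists Hub => //; right; case: nm => [<-//|[_]]; exact: leq_trans.
case=> [<-|[kn km]].
  case: (leqP j k.+1) => kj.
    by exists (High j b); [right; rewrite /= -(xy j kj)|apply: alike_refl].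
  exists (High n false); first by right; right.
  right; split; first exact: ltnW.
  by case: jn => [->|[-> _]]; [apply/ltnW/ltnW|apply: ltnW].
exists (High m false); first by right; right.
right; split; last exact: ltnW.
by case: jn => [E|[<- _]]; [rewrite E in kn|apply: ltnW].
Qed.

Lemma alike_down x y k u v u' : (forall i, i <= k.+1 -> x i = y i) ->
  alike k.+1 u v -> acc u' (u : garland x) ->
  exists2 v', acc v' (v : garland y) & alike k u' v'.
Proof.
move=> xy uv [->|].
  by exists v; [left|apply: alike_leq uv].
case: u' => // n; case: u uv => [|j|j b] //; case: v => [|m|m c] //.
  by move=> _ n0; exists (Low n); [right|left].
have far l : k.+1 < l -> k < l /\ k < l.+1 by move=> kl; split; [|apply: leqW]; apply: ltnW.
case=> [[<- <-]|[/far[kj kj1] /far[_ km1]]] nj.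
  case: (leqP j k.+1) => [kj|/far[kj kj1]].
    by exists (Low n); [right; rewrite /= -(xy j kj)|left].
  (* This lower neighbour of [High j b] is present whatever the bit, whereas [Low j] may be lost. *)
  exists (Low j.+1); first by right; left.
  by right; case: nj => [->|[-> _]].
exists (Low m.+1); first by right; left.
by right; case: nj => [->|[-> _]].
Qed.

Fixpoint depth a := match a with
  | Imp a b => maxn (depth a) (depth b)
  | Box a | Past a => (depth a).+1
  | _ => 0
  end.

(** Each modality uses up one level of likeness. Hence validity of [a] under [hub_val] depends only
    on the bits up to [depth a]. *)
Lemma sat_alike a k x y u v : depth a <= k -> (forall i, i <= k -> x i = y i) ->
  alike k u v -> sat (hub_val x) u a <-> sat (hub_val y) v a.
Proof.
elim: a k x y u v => [n||a IHa b IHb|a IHa|a IHa] k x y u v /=.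
- by move=> _ _; case: u v => [|n'|n' b] [|m|m c].
- by [].
- by rewrite geq_max => /andP[ka kb] xy uv; rewrite (IHa k x y u v) // (IHb k x y u v).
- case: k => // k ka xy uv.
  have xy' i : i <= k -> x i = y i by move=> ik; apply/xy/leqW.
  split=> H w.
    move=> /(alike_up (fun i ik => esym (xy i ik)) (alike_sym uv))[w' uw' ww'].
    exact: (IHa k x y w' w ka xy' (alike_sym ww')).1 (H w' uw').
  move=> /(alike_up xy uv)[w' uw' ww'].
  exact: (IHa k x y w w' ka xy' ww').2 (H w' uw').
- case: k => // k ka xy uv.
  have xy' i : i <= k -> x i = y i by move=> ik; apply/xy/leqW.
  split=> -[w [wu wa]].
    have [w' wv ww'] := alike_down xy uv wu.
    by exists w'; split=> //; apply/(IHa k x y w w' ka xy' ww').1.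
  have [w' wv ww'] := alike_down (fun i ik => esym (xy i ik)) (alike_sym uv) wu.
  by exists w'; split=> //; apply/(IHa k x y w' w ka xy' (alike_sym ww')).2.
Qed.

(** * Compact families and their pretabular logics *)

Definition valid_at x a := forall w, sat (hub_val x) w a.

(* Compactness of [S] for the topology whose basic open sets are the
   [[set x | ~ valid_at x a]]. *)
Definition finitely_covered (S : set (nat -> bool)) :=
  forall psi : (nat -> bool) -> form, (forall x, S x -> ~ valid_at x (psi x)) ->
  exists N (z : nat -> nat -> bool), (forall i, i < N -> S (z i)) /\
    forall y, S y -> exists2 i, i < N & ~ valid_at y (psi (z i)).

Definition meet_logic (S : set (nat -> bool)) : set form :=
  [set a | forall x, S x -> garland_logic x a].

Lemma bigcap_tense (E : set (set form)) :
  (forall L, E L -> tense_logic L) -> tense_logic (\bigcap_(L in E) L).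
Proof.
move=> tE; split=> [a ta L /tE[H _ _ _]|a b Lab La L EL|s a La L EL|a b].
- exact: H.
- by have [_ H _ _] := tE L EL; apply: H (La L EL); apply: Lab.
- by have [_ _ H _] := tE L EL; apply: H (La L EL).
- split=> H L EL; have [_ _ _ /(_ a b)[adj adj']] := tE L EL.
    by apply: adj (H L EL).
  by apply: adj' (H L EL).
Qed.

Lemma meet_logicE S : meet_logic S = \bigcap_(L in garland_logic @` S) L.
Proof.
apply/seteqP; split=> [a Sa L [x Sx <-]|a H x Sx]; first exact: Sa.
by apply: H; exists x.
Qed.

Lemma meet_logic_tense S : tense_logic (meet_logic S).
Proof.
by rewrite meet_logicE; apply: bigcap_tense => L [x _ <-]; apply: garland_logic_tense.
Qed.

Lemma Log_meet_logic S a : (forall x, Log (garland x) a) -> meet_logic S a.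
Proof. by move=> H x _; apply/Log_garland_logic/H. Qed.

Lemma S4t_tense : tense_logic S4t.
Proof. by apply: bigcap_tense => L []. Qed.

Lemma NExt_meet_logic S : NExt S4t (meet_logic S).
Proof.
split; first exact: meet_logic_tense.
apply: smallest_sub; first exact: meet_logic_tense.
move=> a [|[->|->]].
- by apply: smallest_sub => //; apply: meet_logic_tense.
- by apply: Log_meet_logic => x V w /=; apply; left.
- apply: Log_meet_logic => x V w /= H v wv u vu; apply: H; exact: garland_trans wv vu.
Qed.

(** If [M] lay below no [garland_logic x], each [x] in [S] would refute some theorem of [M].
    Finitely many of these suffice for all of [S], and then [M] refutes [spread 20]. *)
Lemma below_garland_logic S M : finitely_covered S -> tense_logic M ->
  meet_logic S `<=` M -> consistent M -> ~ tabular M ->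
  exists2 x, S x & M `<=` garland_logic x.
Proof.
move=> covS tM SM cM ntM; apply: contrapT => nx.
have /choice[psi psiP] : forall x, exists a, S x -> M a /\ ~ valid_at x a.
  move=> x; case: (pselect (S x)) => [Sx|]; last by exists Bot.
  (* The refuting substitution is absorbed into the formula, which stays in [M]. *)
  apply: contrapT => na; apply: nx; exists x => // a Ma s; apply: contrapT => nv.
  apply: na; exists (subst s a) => _; split=> //.
  by case: tM => _ _ Ms _; apply: Ms.
have [N [z [Sz zP]]] := covS psi (fun x Sx => (psiP x Sx).2).
pose D i := subst (fun=> hub) (psi (z i)).
(* Over each garland with [y] in [S], twenty disjoint sets define the hub, and then some [D i] fails
   somewhere. But each [D i] is a theorem of [M]. *)
have M1 : M (Imp (spread 20) (bigOr [seq Ev (Neg (D i)) | i <- iota 0 N])).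
  apply: SM => y Sy; apply: Log_garland_logic => V w sp.
  apply: (sat_bigOr _ _ (fun i => Ev (Neg (D i))) _).2.
  have [i iN /existsNP[v nv]] := zP y Sy; exists i; first by rewrite mem_iota.
  by apply/sat_Ev_garland; exists v => /(sat_subst_hub _ _ sp).
apply: ntM; apply: (@spread_tabular M tM cM _ _ _ 20) => [a|a|a|].
- apply/SM/Log_meet_logic => x V w wa.
  by apply: (sat_Ev_garland V w a).2; exists w.
- apply/SM/Log_meet_logic => x V w.
  suff : sat V w (Dia (Ev a)) -> sat V w (Ev a) by [].
  by move=> /sat_Dia[v _ /sat_Ev_garland va]; apply/sat_Ev_garland.
- apply/SM/Log_meet_logic => x V w.
  suff : sat V w (Past (Ev a)) -> sat V w (Ev a) by [].
  by move=> [v [_ /sat_Ev_garland va]]; apply/sat_Ev_garland.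
- apply: (@canon_complete M tM cM) => G; apply/sat_Neg => sp.
  have /sat_bigOr[i] := @canon_sound M tM cM _ Var G M1 sp.
  rewrite mem_iota => iN /sat_Near[_ [? [_ _ /sat_Near[_ [? [_ _ /sat_Near[_ [u [_ _ nD]]]]]]]]].
  apply/nD/(@canon_sound M tM cM _ Var u).
  by have [_ _ Ms _] := tM; apply/Ms; have [] := psiP _ (Sz i iN).
Qed.

Lemma finitely_covered_image (z : nat -> nat -> bool) n : finitely_covered [set z i | i in `I_n].
Proof.
move=> psi psiP; exists n, z; split=> [i li|_ [i li <-]]; first by exists i.
by exists i => //; apply: psiP; exists i.
Qed.

Lemma garland_logic_pretabular x : pretabular (garland_logic x).
Proof.
split; [exact: garland_logic_consistent|exact: garland_logic_not_tabular|].
move=> M tM [xM nMx] cM; apply: contrapT => ntM.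
(* The family is [{x}], the image of one term of a constant sequence. *)
have [] := below_garland_logic (@finitely_covered_image (fun=> x) 1) tM _ cM ntM.
  by move=> a H; apply/xM/H; exists 0.
by move=> _ [_ _ <-].
Qed.

Lemma PTAB_meet_logic S : finitely_covered S ->
  PTAB (meet_logic S) = garland_logic @` S.
Proof.
move=> covS; apply/seteqP; split=> [M [[tM SM] [cM ntM Mmax]]|_ [x Sx <-]].
  have [x Sx Mx] := below_garland_logic covS tM SM cM ntM.
  (* Were the inclusion proper, pretabularity of [M] would make [garland_logic x] tabular. *)
  exists x => //; apply: contrapT => ne; apply: (@garland_logic_not_tabular x).
  apply: Mmax (garland_logic_tense x) _ (@garland_logic_consistent x).
  by split=> // xM; apply: ne; apply/seteqP.
split; last exact: garland_logic_pretabular.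
by split=> [|a]; [exact: garland_logic_tense|apply].
Qed.

Lemma PTAB_meet_logic_card S : finitely_covered S -> PTAB (meet_logic S) #= S.
Proof.
move=> covS; rewrite PTAB_meet_logic //; apply: inj_card_eq => x y _ _.
exact: garland_logic_inj.
Qed.

(* A sequence converging to its first term. *)
Definition converging k : nat -> bool := fun j => k == j.+1.

Lemma converging_inj : injective converging.
Proof.
move=> k l E; have {E} H n : (k == n.+1) = (l == n.+1) := congr1 (fun x => x n) E.
case: k l H => [|k] [|l] H //; first by have := H l; rewrite eqxx.
  by have := H k; rewrite eqxx.
by have := H k; rewrite eqxx => /esym/eqP.
Qed.

(** The formula refuted at the limit [converging 0] is refuted at every term agreeing with it up to
    the depth, hence at all but finitely many terms. *)
Lemma finitely_covered_converging : finitely_covered (range converging).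
Proof.
move=> psi psiP; pose a := psi (converging 0).
(* For [k] at least [(depth a).+2] the only true bit of [converging k] is at [k.-1], beyond the
   depth of [a]. *)
exists (depth a).+2, converging; split=> [i _|_ [k _ <-]]; first by exists i.
case: (ltnP k (depth a).+2) => kd; first by exists k => //; apply: psiP; exists k.
exists 0 => // kv; apply: (psiP (converging 0)); first by exists 0.
move=> w; apply: (@sat_alike a (depth a) (converging 0) (converging k) w w _ _ _).2 => //.
  move=> i ia; rewrite /converging; apply/esym/negbTE; rewrite neq_ltn orbC.
  by rewrite (leq_trans _ kd).
exact: alike_refl.
Qed.

(** * Cardinalities *)

(** Embeds formulas into a countable type, so that there are at most continuum many logics. *)
Fixpoint form_code a : GenTree.tree nat := match a with
  | Var n => GenTree.Leaf n
  | Bot => GenTree.Node 0 [::]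
  | Imp a b => GenTree.Node 1 [:: form_code a; form_code b]
  | Box a => GenTree.Node 2 [:: form_code a]
  | Past a => GenTree.Node 3 [:: form_code a]
  end.

Lemma form_code_inj : injective form_code.
Proof.
elim=> [n||a IHa b IHb|a IHa|a IHa] [m||c d|c|c] //= [].
- by move->.
- by move=> /IHa -> /IHb ->.
- by move=> /IHa ->.
- by move=> /IHa ->.
Qed.

Lemma set_form_le : [set: set form] #<= [set: set nat].
Proof.
apply/pcard_injP; exists (fun L => [set pickle (form_code a) | a in L]).
have H (L L' : set form) : [set pickle (form_code a) | a in L] =
    [set pickle (form_code a) | a in L'] -> L `<=` L'.
  move=> E a La; have : [set pickle (form_code b) | b in L'] (pickle (form_code a)).
    by rewrite -E; exists a.
  by move=> [b Lb /(pcan_inj pickleK) /form_code_inj <-].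
by move=> L L' _ _ E; apply/seteqP; split; apply: H.
Qed.

Lemma PTAB_S4t : PTAB S4t #= [set: set nat].
Proof.
apply/card_eqPle; split.
  exact: card_le_trans (card_leT _) set_form_le.
pose f (X : set nat) := garland_logic (fun n => `[<X n>]).
have f_inj : {in [set: set nat] &, injective f}.
  move=> X Y _ _ /garland_logic_inj E.
  have {E} H n : `[<X n>] = `[<Y n>] := congr1 (fun h => h n) E.
  by apply/seteqP; split=> n /asboolP; [rewrite H|rewrite -H] => /asboolP.
have /card_eqPle[_ le] := inj_card_eq f_inj.
apply: card_le_trans le (subset_card_le _) => _ [X _ <-].
split; last exact: garland_logic_pretabular.
have [_ S4] := NExt_meet_logic [set (fun n => `[<X n>])].
by split=> [|a /S4 H]; [exact: garland_logic_tense|apply: H].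
Qed.

(* The cardinal kappa is that of an arbitrary type K. *)
Theorem theorem8p23 (K : Type) :
  [set: K] #<= [set: nat] \/ [set: K] #= [set: set nat] ->
  exists L : set form, NExt S4t L /\ PTAB L #= [set: K].
Proof.
have meet S : finitely_covered S -> S #= [set: K] ->
    exists L : set form, NExt S4t L /\ PTAB L #= [set: K].
  move=> covS SK; exists (meet_logic S); split; first exact: NExt_meet_logic.
  exact: card_eq_trans (PTAB_meet_logic_card covS) SK.
move=> [Kle|Keq]; last first.
  (* For the continuum the least logic itself serves. *)
  exists S4t; split; first by split=> //; exact: S4t_tense.
  exact: card_eq_trans PTAB_S4t (card_esym Keq).
have card_conv J : [set converging k | k in J] #= J.
  by apply: inj_card_eq => k l _ _; apply: converging_inj.
(* A finite cardinal [n] uses the first [n] terms of the convergent sequence, and the countably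
   infinite one uses all of them. *)
case: (pselect (finite_set [set: K])) => [/finite_setP[n Kn]|/infiniteP Kge].
  apply: (meet _ (@finitely_covered_image converging n)).
  exact: card_eq_trans (card_conv _) (card_esym Kn).
apply: (meet _ finitely_covered_converging).
by apply: card_eq_trans (card_conv _) _; apply/card_eqPle.
Qed.
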